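(* For every $\mathbf{y}\in\mathbb{R}^n$, $$\omega^\times(\mathbf{y})=\max_{1\le k\le n}\frac{n+n\gamma_k(\mathbf{y})}{1-k\gamma_k(\mathbf{y})}.$$
   Context: For $\mathbf{y}\in\mathbb{R}^n$, $\Pi_+(\mathbf{q})=\prod_i\max(1,|q_i|)$ and $\omega^\times(\mathbf{y})=\sup\{v\mid$ there are infinitely many $\mathbf{q}\in\mathbb{Z}^n$ with $|\langle\mathbf{q},\mathbf{y}\rangle+p|<\Pi_+(\mathbf{q})^{-v/n}$ for some $p\in\mathbb{Z}\}$. For $\mathbf{t}=(t_1,\dots,t_n)\in\mathbb{R}_{\ge0}^n$ put $t=\sum_i t_i$ and $g_{\mathbf{t}}=\mathrm{diag}(e^{-t_1},\dots,e^{-t_n},e^{t})\in SL(n+1,\mathbb{R})$; let $u_{\mathbf{y}}=\begin{pmatrix}I_n&0\\ \mathbf{y}&1\end{pmatrix}$ (with $\mathbf{y}$ a row vector), so $u_{\mathbf{y}}(\mathbf{q},p)^T=(\mathbf{q},\langle\mathbf{q},\mathbf{y}\rangle+p)^T$. Let $\mathbb{Z}^{n+1}_k$ be the set of $(q_1,\dots,q_n,p)\in\mathbb{Z}^{n+1}$ with exactly $k$ of $q_1,\dots,q_n$ nonzero. Norms on $\mathbb{R}^{n+1}$ are Euclidean. For $1\le k\le n$, $\gamma_k(\mathbf{y})$ is the supremum of those $c\in(0,1/k)$ such that there is an unbounded set of $\mathbf{t}\in\mathbb{R}_{\ge0}^n$ satisfying $t_i\ge ct$ for at least $k$ values of $i$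 and such that $g_{\mathbf{t}}u_{\mathbf{y}}\mathbb{Z}^{n+1}_k$ contains at least one vector of norm $\le e^{-ct}$, with the convention that this supremum is $0$ if no such $c$ exists. *)

(* Defs.v *)
From HB Require Import structures.
From mathcomp Require Import all_boot all_order all_algebra.
From mathcomp Require Import all_classical all_reals all_analysis.

Set Implicit Arguments.
Unset Strict Implicit.
Unset Printing Implicit Defensive.

Import Order.TTheory GRing.Theory Num.Theory.
Import numFieldNormedType.Exports.

Local Open Scope classical_set_scope.
Local Open Scope ring_scope.

Section MultiplicativeExponent.
Variables (R : realType) (n : nat).

Definition Pi_plus (q : 'rV[int]_n) : R :=
  \prod_(i < n) Num.max 1 `|(q 0 i)%:~R|.

Definition inner (q : 'rV[int]_n) (y : 'rV[R]_n) : R :=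
  \sum_(i < n) (q 0 i)%:~R * y 0 i.

(* Valued in the extended reals: the set of admissible [v] may be unbounded. *)
Definition omega_times (y : 'rV[R]_n) : \bar R :=
  ereal_sup [set v%:E | v in [set v : R |
    infinite_set [set q : 'rV[int]_n |
      exists p : int, `|inner q y + p%:~R| < Pi_plus q `^ (- v / n%:R)]]].

End MultiplicativeExponent.

Section Dynamics.
Variables (R : realType) (n : nat).

(* The library norm on matrices is the sup norm, hence this definition. *)
Definition euclidean_norm m (x : 'cV[R]_m) : R :=
  Num.sqrt (\sum_(i < m) x i 0 ^+ 2).

Definition tsum (t : 'rV[R]_n) : R := \sum_(i < n) t 0 i.

Definition g_ (t : 'rV[R]_n) : 'M[R]_(n + 1) :=
  block_mx (diag_mx (\row_(i < n) expR (- t 0 i))) 0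
           0                                       (expR (tsum t))%:M.

Definition u_ (y : 'rV[R]_n) : 'M[R]_(n + 1) :=
  block_mx 1%:M 0
           y    1%:M.

(* An integer vector is a column [col_mx q p] with [q] of height [n] and [p] of
   height 1; [usubmx] recovers [q], so [p] is not counted. *)
Definition Zlat (k : nat) : set 'cV[int]_(n + 1) :=
  [set z | #|[set i : 'I_n | (usubmx z i 0 != 0)%R]%SET| = k].

Definition gamma_cond (k : nat) (y : 'rV[R]_n) (c : R) (t : 'rV[R]_n) : Prop :=
  [/\ forall i, 0 <= t 0 i,
      (k <= #|[set i : 'I_n | (c * tsum t <= t 0 i)%R]%SET|)%N
    & exists2 x : 'cV[R]_(n + 1),
        [set g_ t *m u_ y *m map_mx intr z | z in Zlat k] x
        & euclidean_norm x <= expR (- c * tsum t)].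

(* [sup set0 = 0] in the library, which is the required convention. The set is
   bounded above by [k%:R^-1], so [sup] is the actual supremum otherwise. *)
Definition gamma (k : nat) (y : 'rV[R]_n) : R :=
  sup [set c : R | 0 < c < k%:R^-1 /\
                   ~ bounded_set [set t | gamma_cond k y c t]].

End Dynamics.

(* Main.v *)
(* If [g_t u_y (q, p)] has norm at most [e^(-c t)], then the [k] nonzero entries
   of [q] satisfy [|q_i| <= e^(t_i - c t)], so [Pi_plus q <= e^((1 - k c) t)],
   while [|<q, y> + p| <= e^(-(1 + c) t)]: hence [q] has exponent
   [v = n (1 + c) / (1 - k c)]. Conversely an approximation of exponent [v] by a
   [q] with [k] nonzero entries determines [t], up to an arbitrarily small loss in
   [c] which absorbs the factor [sqrt (n + 1)] from the Euclidean norm. Unbounded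
   [t] yields infinitely many [q], unless some [<q, y> + p] with [q <> 0] vanishes;
   then the multiples of [q] give [omega_times y = +oo]. Terms with [gamma = 0] are
   covered by Dirichlet's theorem in one variable. *)
Require Import Defs.
From HB Require Import structures.
From mathcomp Require Import all_boot all_order all_algebra.
From mathcomp Require Import all_classical all_reals all_analysis.
From mathcomp Require Import ring lra.
Import Order.TTheory GRing.Theory Num.Theory.
Import numFieldNormedType.Exports.
Local Open Scope classical_set_scope.
Local Open Scope ring_scope.

(** * Euclidean norm against coordinates *)

Lemma norm_le_euclidean_norm (R : realType) (m : nat) (x : 'cV[R]_m) (i : 'I_m) :
  `|x i 0| <= euclidean_norm x.
Proof.
rewrite -sqrtr_sqr /euclidean_norm ler_wsqrtr// (bigD1 i)//= lerDl.
by apply: sumr_ge0 => j _; exact: sqr_ge0.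
Qed.

Lemma euclidean_norm_le (R : realType) (m : nat) (x : 'cV[R]_m) (e : R) :
  0 <= e -> (forall i, `|x i 0| <= e) ->
  euclidean_norm x <= Num.sqrt m%:R * e.
Proof.
move=> e0 xe; rewrite -[e in leRHS]ger0_norm// -sqrtr_sqr -sqrtrM//.
rewrite /euclidean_norm ler_wsqrtr// mulr_natl.
have -> : e ^+ 2 *+ m = \sum_(i < m) e ^+ 2 by rewrite sumr_const card_ord.
by apply: ler_sum => i _; rewrite -real_normK ?num_real// ler_sqr ?nnegrE.
Qed.

(** * Coordinates of the moved lattice vectors, and logarithms of [Pi_plus] *)

Section Coordinates.
Variables (R : realType) (n : nat).
Implicit Types (q : 'rV[int]_n) (t y : 'rV[R]_n).

Definition nsupp q : nat := #|[set i | q 0 i != 0]%SET|.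

Lemma gu_coords t y (z : 'cV[int]_(n + 1)) :
  g_ t *m u_ y *m map_mx intr z =
  col_mx (\col_i (expR (- t 0 i) * (usubmx z i 0)%:~R))
    (\col_i (expR (tsum t) * (inner (usubmx z)^T y + (dsubmx z 0 0)%:~R))).
Proof.
rewrite -[z in LHS]vsubmxK map_col_mx -mulmxA /u_ mul_block_col /g_ mul_block_col.
rewrite !mul1mx !mul0mx !addr0 add0r; congr col_mx.
  by apply/matrixP => i j; rewrite mul_diag_mx !mxE !ord1.
apply/matrixP => i j; rewrite mul_scalar_mx !mxE !ord1; congr (_ * (_ + _)).
by apply: eq_bigr => k _; rewrite !mxE mulrC.
Qed.

Lemma nsupp_tr (z : 'cV[int]_(n + 1)) :
  #|[set i : 'I_n | (usubmx z i 0 != 0)%R]%SET| = nsupp (usubmx z)^T.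
Proof. by apply: eq_card => i; rewrite !inE !mxE. Qed.

Lemma ln_max_ge0 (a : R) : 0 <= ln (Num.max 1 a).
Proof. by rewrite ln_ge0// le_max lexx. Qed.

Lemma Pi_plus_expR q :
  Pi_plus R q = expR (\sum_(i < n) ln (Num.max 1 `|(q 0 i)%:~R|)).
Proof.
rewrite expR_sum; apply: eq_bigr => i _.
by rewrite lnK// posrE lt_max ltr01.
Qed.

Lemma ln_Pi_plus q :
  ln (Pi_plus R q) = \sum_(i < n) ln (Num.max 1 `|(q 0 i)%:~R|).
Proof. by rewrite Pi_plus_expR expRK. Qed.

Lemma Pi_plus_gt0 q : 0 < Pi_plus R q.
Proof. by rewrite Pi_plus_expR expR_gt0. Qed.

Lemma ln_Pi_plus_ge0 q : 0 <= ln (Pi_plus R q).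
Proof. by rewrite ln_Pi_plus sumr_ge0// => i _; exact: ln_max_ge0. Qed.

Lemma powR_Pi_plus q (a : R) : Pi_plus R q `^ a = expR (a * ln (Pi_plus R q)).
Proof. by rewrite /powR gt_eqF// Pi_plus_gt0. Qed.

Lemma ln_max_le_Pi_plus q i :
  ln (Num.max 1 `|(q 0 i)%:~R|) <= ln (Pi_plus R q).
Proof.
rewrite ln_Pi_plus (bigD1 i)//= lerDl sumr_ge0// => j _; exact: ln_max_ge0.
Qed.

(** Every factor of the product is at least 1, so each [|q_i|] is at most [B]. Removing such a set
    from an infinite one leaves vectors with [Pi_plus] as large as desired. *)
Lemma finite_Pi_plus_le (B : R) : finite_set [set q : 'rV[int]_n | Pi_plus R q <= B].
Proof.
pose M := (Num.trunc B).+1.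
(* A bounded integer vector is encoded by the moduli and signs of its entries. *)
pose f (s : {ffun 'I_n -> 'I_M.+1 * bool}) : 'rV[int]_n :=
  \row_i (if (s i).2 then - ((s i).1 : nat)%:Z else ((s i).1 : nat)%:Z).
apply: (@sub_finite_set _ _ (f @` setT)); last exact/finite_image/finite_finset.
move=> q /= qB.
have qM (i : 'I_n) : (absz (q 0%R i) < M.+1)%N.
  have B0 : 0 <= B by exact: le_trans (ltW (Pi_plus_gt0 q)) qB.
  have /andP[_ BM] := truncn_itv B0.
  rewrite ltnS -(ler_nat R) (le_trans _ (ltW BM))// (le_trans _ qB)//.
  rewrite natr_absz intr_norm.
apply: (@le_trans _ _ (Num.max 1 `|(q 0 i)%:~R|)); first by rewrite le_max lexx orbT.
rewrite -ler_ln ?posrE ?Pi_plus_gt0 ?lt_max ?ltr01//; exact: ln_max_le_Pi_plus.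
exists [ffun i => (Ordinal (qM i), q 0%R i < 0)] => //=.
apply/rowP => i; rewrite !mxE ffunE /=.
rewrite abszE; case: ltrP => q0; [rewrite ltr0_norm|rewrite ger0_norm]; rewrite ?opprK//.
Qed.
End Coordinates.

(** On nonnegative vectors the sum of the entries dominates the sup norm and is at most [n] times
    it. *)
Lemma unbounded_tsum (R : realType) (n : nat) (A : set 'rV[R]_n) :
  (forall t, A t -> forall i, 0 <= t 0 i) ->
  ~ bounded_set A <-> forall M, exists2 t, A t & M < tsum t.
Proof.
move=> A0; split=> [nb M|AM].
  apply: contrapT => /forall2NP nA; apply: nb.
  exists (Num.max 0 M); split => [|N MN t /= At]; first exact: num_real.
  have [N0 {}MN] : 0 <= N /\ M <= N by move: MN; rewrite gt_max => /andP[/ltW ? /ltW].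
  rewrite [leLHS]mx_normrE; apply: bigmax_le => [//|[i j] _ /=].
  rewrite ord1 ger0_norm ?A0//; have [//|/negP] := nA t.
  rewrite -leNgt => tM; apply: le_trans MN; apply: le_trans tM.
  rewrite /tsum (bigD1 j)//= lerDl sumr_ge0// => k _; exact: A0.
case=> M [Mreal HM].
have [t At] := AM ((`|M| + 1) *+ n).
apply/negP; rewrite -leNgt.
have -> : (`|M| + 1) *+ n = \sum_(i < n) (`|M| + 1) by rewrite sumr_const card_ord.
apply: ler_sum => i _.
have := HM (`|M| + 1) _ t At; rewrite (le_lt_trans (ler_norm _)) ?ltrDl// => /(_ isT).
apply: le_trans; rewrite [leRHS]mx_normrE.
apply: le_trans (ler_norm _) _.
exact: (le_bigmax _ (fun ij : 'I_1 * 'I_n => `|t ij.1 ij.2|) (ord0, i)).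
Qed.

(** * From flow times to approximations and back *)

Section Correspondence.
Variables (R : realType) (n : nat) (y : 'rV[R]_n).
Implicit Types (q : 'rV[int]_n) (t : 'rV[R]_n).

Lemma gamma_cond_approx k c t : gamma_cond k y c t ->
  exists q p, [/\ nsupp n q = k,
    ln (Pi_plus R q) <= (1 - k%:R * c) * tsum t &
    `|inner q y + p%:~R| <= expR (- (1 + c) * tsum t)].
Proof.
case=> t0 _ [_ [z zk <-]]; rewrite gu_coords; set x := col_mx _ _ => xc.
exists (usubmx z)^T, (dsubmx z 0 0); split.
- by rewrite -nsupp_tr.
- rewrite -zk nsupp_tr /nsupp ln_Pi_plus mulrBl mul1r -sum1_card natr_sum -mulrA.
  rewrite mulr_suml [X in _ - X]big_mkcond /tsum -sumrB; apply: ler_sum => i _.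
  (* A zero entry contributes [ln 1 = 0], which is at most [t_i]; a nonzero integer has modulus at
     least 1, so the maximum is [|q_i|]. *)
  rewrite inE mxE -/(tsum t); case: eqP => [->|/eqP zi] /=.
    by rewrite normr0 max_l// ln1 subr0.
  have zi1 : 1 <= `|(usubmx z i 0)%:~R : R|.
    by rewrite -intr_norm ler1z -gtz0_ge1 normr_gt0.
  rewrite max_r// mul1r -ler_expR lnK ?posrE ?(lt_le_trans ltr01)//.
  have := le_trans (norm_le_euclidean_norm _ _ x (lshift 1 i)) xc.
  rewrite col_mxEu mxE normrM gtr0_norm ?expR_gt0// expRN.
  by rewrite mulrC ler_pdivrMr ?expR_gt0// -expRD addrC mulNr.
- have := le_trans (norm_le_euclidean_norm _ _ x (rshift n 0)) xc.
  rewrite col_mxEd mxE normrM gtr0_norm ?expR_gt0//.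
  rewrite mulrC -ler_pdivlMr ?expR_gt0// -expRN -expRD => /le_trans; apply.
  by rewrite ler_expR; lra.
Qed.

(* The flow time is chosen so that all nonzero entries of
   [g_ t *m u_ y *m (q, p)] among the first [n] have modulus [expR (- c T)]. *)
Lemma approx_gamma_cond k c c' q p :
  0 <= c' <= c -> k%:R * c < 1 -> nsupp n q = k ->
  `|inner q y + p%:~R| <=
    Pi_plus R q `^ (- ((1 + c) / (1 - k%:R * c))) ->
  let T := ln (Pi_plus R q) / (1 - k%:R * c) in
  Num.sqrt (n + 1)%:R <= expR ((c - c') * T) ->
  exists2 t, gamma_cond k y c' t & tsum t = T.
Proof.
move=> /andP[c'0 c'c] kc qk qp T nT.
have c0 : 0 <= c := le_trans c'0 c'c.
have T0 : 0 <= T by rewrite divr_ge0 ?ln_Pi_plus_ge0// subr_ge0 ltW.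
pose t := \row_i (ln (Num.max 1 `|(q 0 i)%:~R|) + (q 0 i != 0)%:R * (c * T)) : 'rV[R]_n.
(* The entries add up to [ln (Pi_plus R q) + k c T], and [T] was chosen as the solution of
   [T = ln (Pi_plus R q) + k c T]. *)
have tT : tsum t = T.
  rewrite /tsum; under eq_bigr do rewrite mxE.
  rewrite big_split /= -ln_Pi_plus -mulr_suml.
  have -> : \sum_(i < n) (q 0 i != 0)%:R = k%:R :> R.
    rewrite -qk /nsupp -sum1_card natr_sum [RHS]big_mkcond /=.
    by apply: eq_bigr => i _; rewrite inE; case: (_ != _).
  have : T * (1 - k%:R * c) = ln (Pi_plus R q) by rewrite divfK// gt_eqF// subr_gt0.
  lra.
have tc i : q 0 i != 0 -> c * T <= t 0 i.
  by move=> qi; rewrite mxE qi mul1r lerDr ln_max_ge0.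
exists t => //; split.
- by move=> i; rewrite mxE addr_ge0 ?ln_max_ge0// mulr_ge0 ?ler0n// mulr_ge0.
- rewrite -qk tT; apply/subset_leq_card/fintype.subsetP => i; rewrite !inE => /tc.
  by apply: le_trans; rewrite ler_wpM2r.
- pose z : 'cV[int]_(n + 1) := col_mx q^T (\col_i p).
  exists (g_ t *m u_ y *m map_mx intr z).
    by exists z => //; rewrite /Zlat /= nsupp_tr col_mxKu trmxK.
  apply: (@le_trans _ _ (Num.sqrt (n + 1)%:R * expR (- (c * T)))).
    rewrite gu_coords; apply: euclidean_norm_le; first exact: expR_ge0.
    move=> i; rewrite -(splitK i); case: (fintype.split i) => j /=.
      rewrite col_mxEu mxE col_mxKu [q^T j 0]mxE [t 0 j]mxE normrM gtr0_norm ?expR_gt0//.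
      have [->|qj] := eqVneq (q 0 j) 0; first by rewrite mulr0z normr0 mulr0 expR_ge0.
      have qj1 : 1 <= `|(q 0 j)%:~R : R|.
        by rewrite -intr_norm ler1z -gtz0_ge1 normr_gt0.
      rewrite mul1r max_r// opprD expRD (expRN (ln _)) lnK ?posrE ?(lt_le_trans ltr01)//.
      by rewrite mulrAC mulVf ?mul1r// gt_eqF// (lt_le_trans ltr01).
    (* In terms of [T] the hypothesis reads [|<q, y> + p| <= e^(-(1 + c) T)], and the flow
       multiplies this by [e^T]. *)
    rewrite col_mxEd mxE col_mxKu col_mxKd trmxK mxE normrM gtr0_norm ?expR_gt0//.
    rewrite mulrC -ler_pdivlMr ?expR_gt0// (le_trans qp)// powR_Pi_plus -expRN -expRD.
    rewrite ler_expR tT mulNr mulrAC -mulrA -/T; lra.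
  rewrite tT; apply: le_trans (_ : expR ((c - c') * T) * expR (- (c * T)) <= _).
    by rewrite ler_wpM2r ?expR_ge0.
  by rewrite -expRD ler_expR; lra.
Qed.

Lemma unbounded_gamma_cond k c c' : 0 < c' < c -> k%:R * c < 1 ->
  infinite_set [set q | nsupp n q = k /\ exists p : int, 
    `|inner q y + p%:~R| < Pi_plus R q `^ (- ((1 + c) / (1 - k%:R * c)))] ->
  ~ bounded_set [set t | gamma_cond k y c' t].
Proof.
move=> /andP[c'0 c'c] kc qinf; apply/unbounded_tsum => [t []//|M].
have kc0 : 0 < 1 - k%:R * c by rewrite subr_gt0.
(* Exceeding the first bound gives [T > M]; exceeding the second gives
   [e^((c - c') T) > sqrt (n + 1)]. *)
pose B := Num.max (expR ((1 - k%:R * c) * M)) 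
  (expR ((1 - k%:R * c) * (ln (Num.sqrt (n + 1)%:R) / (c - c')))).
have [q [[qk [p qp]] /negP]] := infinite_setN0 (infinite_setD qinf (finite_Pi_plus_le R n B)).
rewrite -ltNge gt_max Pi_plus_expR -ln_Pi_plus !ltr_expR => /andP[qM qn].
have sn0 : 0 < Num.sqrt (n + 1)%:R :> R by rewrite sqrtr_gt0 ltr0n addn1.
have cc : 0 <= c' <= c by rewrite !ltW.
have [|t tc tT] := approx_gamma_cond _ _ _ _ _ cc kc qk (ltW qp).
  rewrite -[X in X <= _]lnK ?posrE// ler_expR mulrC.
  by rewrite -ler_pdivrMr ?subr_gt0// ler_pdivlMr// mulrC ltW.
by exists t => //; rewrite tT ltr_pdivlMr// mulrC.
Qed.

End Correspondence.

(** * Approximation of one real number *)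

Lemma dist_int_gt0 (R : realType) (x : R) : (forall p : int, x + p%:~R != 0) ->
  exists2 e, 0 < e & forall p : int, e <= `|x + p%:~R|.
Proof.
move=> x0; pose f := x - (Num.floor x)%:~R.
have /andP[fl fu] := floor_itv x.
have f0 : 0 < f by rewrite lt_neqAle subr_ge0 fl andbT eq_sym /f -mulrNz x0.
have f1 : f < 1 by rewrite /f ltrBlDr addrC -[1]/(1%:~R) -intrD.
(* The distances from [x] to its two neighbouring integers. *)
exists (Num.min f (1 - f)); first by rewrite lt_min f0 subr_gt0.
move=> p; have -> : x + p%:~R = f + (p + Num.floor x)%:~R by rewrite intrD /f; ring.
have [m0|m0] := leP 0 (p + Num.floor x).
  have : 0 <= (p + Num.floor x)%:~R :> R by rewrite ler0z.
  move=> m0R; rewrite ger0_norm ?ge_min; first by apply/orP; left; lra.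
  lra.
have : (p + Num.floor x)%:~R <= (-1)%:~R :> R by rewrite ler_int -ltzD1.
move=> mR; rewrite ler0_norm ?ge_min; first by apply/orP; right; lra.
lra.
Qed.

(** Pigeonhole: the [N + 1] fractional parts of [i x], [0 <= i <= N], lie in [N] half-open intervals
    of length [1 / N], and two in the same interval differ by less than [1 / N]. *)
Lemma dirichlet (R : realType) (x : R) (N : nat) : (0 < N)%N ->
  exists (m : nat) (p : int), (0 < m <= N)%N /\ `|m%:R * x + p%:~R| < N%:R^-1.
Proof.
move=> N0; pose fl (i : nat) := Num.floor (i%:R * x).
pose f (i : nat) := i%:R * x - (fl i)%:~R.
have f01 i : 0 <= f i < 1.
  have /andP[h1 h2] := floor_itv (i%:R * x).
  by rewrite subr_ge0 h1 /= /f ltrBlDr addrC -[1]/(1%:~R) -intrD.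
have NR : 0 < N%:R :> R by rewrite ltr0n.
have box0 i : 0 <= N%:R * f i by have /andP[? ?] := f01 i; rewrite mulr_ge0// ltW.
have box (i : 'I_N.+1) : (Num.trunc (N%:R * f i) < N)%N.
  have /andP[h _] := truncn_itv (box0 i); have /andP[_ fi1] := f01 i.
  by rewrite -(ltr_nat R) (le_lt_trans h)// gtr_pMr.
have /injectivePn[i [j ij [eqb]]] : ~~ injectiveb (fun i => Ordinal (box i)).
  by apply/negP => /injectiveP /leq_card; rewrite !card_ord ltnn.
wlog ltij : i j ij eqb / (i < j)%N => [wl|].
  have [lt|lt|/val_inj e] := ltngtP i j; first exact: wl ij eqb lt.
    by apply: (wl j i) => //; rewrite eq_sym.
  by rewrite e eqxx in ij.
exists (j - i)%N, (fl i - fl j); split.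
  by rewrite subn_gt0 ltij /= (leq_trans (leq_subr _ _))// -ltnS.
have -> : (j - i)%:R * x + (fl i - fl j)%:~R = f j - f i.
  by rewrite natrB 1?ltnW// intrB /f; ring.
rewrite -[ltRHS]mul1r ltr_pdivlMr// -[N%:R]ger0_norm ?ler0n// -normrM mulrC mulrBr.
have /andP[a1 a2] := truncn_itv (box0 i); have /andP[b1 b2] := truncn_itv (box0 j).
move: a1 a2 b1 b2; rewrite eqb -natr1 => a1 a2 b1 b2.
by rewrite ltr_norml; apply/andP; split; lra.
Qed.

(** * Lower bounds for the exponent *)

Section Exponent.
Variables (R : realType) (n : nat) (y : 'rV[R]_n).
Implicit Types q : 'rV[int]_n.

Lemma omega_times_ge v :
  infinite_set [set q | exists p : int,
    `|inner q y + p%:~R| < Pi_plus R q `^ (- v / n%:R)] ->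
  (v%:E <= omega_times y)%E.
Proof. by move=> inf; apply: ereal_sup_ubound; exists v. Qed.

Lemma omega_times_relation q p : q != 0 -> inner q y + p%:~R = 0 ->
  omega_times y = +oo%E.
Proof.
move=> q0 qp; apply/eqyP => v _; apply: omega_times_ge.
pose f (m : nat) : 'rV[int]_n := m%:Z *: q.
have finj : injective f.
  have [i qi] : exists i, q 0 i != 0 by apply/rV0Pn.
  by move=> a b /matrixP/(_ 0 i); rewrite !mxE => /(mulIf qi) [].
apply: (@sub_infinite_set _ (f @` setT)).
  move=> _ [m _ <-] /=; exists (m%:Z * p).
  have -> : inner (f m) y + (m%:Z * p)%:~R = m%:R * (inner q y + p%:~R).
    rewrite mulrDr intrM -pmulrn; congr (_ + _); rewrite /inner mulr_sumr.
    by apply: eq_bigr => i _; rewrite mxE intrM -pmulrn mulrA.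
  by rewrite qp mulr0 normr0 powR_gt0// Pi_plus_gt0.
apply/infiniteP; have := @inj_card_eq _ _ setT f (in2W finj).
by rewrite card_eq_le => /andP[].
Qed.

(** Without an integer relation, finitely many nonzero [q] keep a common positive distance from the
    integers. This is how a set of solutions is shown to be infinite when the exponent is not
    [+oo]. *)
Lemma omega_times_pinfty (A : set 'rV[int]_n) : finite_set A ->
  (forall e, 0 < e -> exists q, [/\ A q, q != 0 &
     exists p : int, `|inner q y + p%:~R| < e]) ->
  omega_times y = +oo%E.
Proof.
move=> /finite_seqP[s ->] As; apply: contrapT => nrel.
have [e e0 es] : exists2 e, 0 < e & forall q (p : int), q \in s -> q != 0 ->
    e <= `|inner q y + p%:~R|.
  elim: s {As} => [|q s [e e0 es]]; first by exists 1.
  have [->|q0] := eqVneq q 0.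
    exists e => // q' p; rewrite inE => /orP[/eqP ->|]; first by rewrite eqxx.
    exact: es.
  have [p|d d0 dq] := @dist_int_gt0 _ (inner q y).
    by apply/eqP => qp; apply: nrel; exact: omega_times_relation qp.
  exists (Num.min e d); first by rewrite lt_min e0.
  move=> q' p; rewrite inE ge_min => /orP[/eqP ->|q's q'0]; first by rewrite dq orbT.
  by rewrite es.
have [q [/= qs q0 [p]]] := As e e0.
by rewrite ltNge es.
Qed.

(** For [q] equal to [m] times a basis vector, [Pi_plus] is [m], and exponent [n] asks for an error
    below [1 / m]. Dirichlet gives an error below [1 / N] with [m <= N], and [N] is free to grow. *)
Lemma omega_times_ge_n (hn : (0 < n)%N) : (n%:R%:E <= omega_times y)%E.
Proof.
have [->|nrel] := pselect (omega_times y = +oo%E); first exact: leey.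
apply: omega_times_ge => fin; apply: nrel; apply: omega_times_pinfty fin _ => e e0.
pose N := (Num.trunc e^-1).+1; pose i0 := Ordinal hn.
have Ne : N%:R^-1 < e.
  rewrite invf_plt ?posrE//.
  have ei : 0 <= e^-1 by rewrite invr_ge0 ltW.
  by have /andP[_] := truncn_itv ei.
have [m [p [/andP[m0 mN] mp]]] := dirichlet _ (y 0 i0) N isT.
pose q : 'rV[int]_n := m%:Z *: delta_mx 0 i0.
have qi0 : q 0 i0 = m by rewrite !mxE !eqxx mulr1.
have qi i : i != i0 -> q 0 i = 0 by move=> ii; rewrite !mxE (negbTE ii) andbF mulr0.
have qp : inner q y + p%:~R = m%:R * y 0 i0 + p%:~R.
  rewrite /inner (bigD1 i0)//= qi0 big1 ?addr0// => i /qi ->.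
  by rewrite mul0r.
have Pq : Pi_plus R q = m%:R.
  rewrite /Pi_plus (bigD1 i0)//= qi0 big1 ?mulr1 => [|i /qi ->].
    by rewrite ger0_norm ?ler0z// max_r// -[1]/(1%:~R) ler_int.
  by rewrite normr0 max_l.
exists q; split.
- exists p; rewrite qp mulNr divff ?gt_eqF ?ltr0n// powR_inv1 Pq ?ler0n//.
  apply: lt_le_trans mp _.
  by rewrite lef_pV2 ?posrE ?ltr0n// ler_nat.
- by apply/rV0Pn; exists i0; rewrite qi0 -lt0n.
- by exists p; rewrite qp (lt_trans mp).
Qed.

Lemma omega_times_ge_gamma_cond k c : (0 < k)%N -> 0 < c -> k%:R * c < 1 ->
  ~ bounded_set [set t | gamma_cond k y c t] ->
  ((n%:R * ((1 + c) / (1 - k%:R * c)))%:E <= omega_times y)%E.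
Proof.
move=> k0 c0 kc; set w := (1 + c) / _.
move=> /unbounded_tsum unb.
have kc0 : 0 < 1 - k%:R * c by rewrite subr_gt0.
have wE : 1 + c = w * (1 - k%:R * c) by rewrite divfK// gt_eqF.
have w0 : 0 <= w by rewrite divr_ge0 ?ltW//; lra.
move: w wE w0 => w wE w0.
have [->|nrel] := pselect (omega_times y = +oo%E); first exact: leey.
(* The flow yields only a weak inequality at exponent [w]; the strict one is recovered below at the
   cost of [e]. *)
pose A := [set q : 'rV[int]_n | q != 0 /\ exists p : int,
  `|inner q y + p%:~R| <= Pi_plus R q `^ (- w)].
have Ainf : infinite_set A.
  move=> fin; apply: nrel; apply: omega_times_pinfty fin _ => e e0.
  (* With [tsum t] positive and above [- ln e], the error [e^(-(1 + c) t)] is below [e]. *)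
  have [|t tc tM] := unb _ (Num.max 0 (- ln e)); first by move=> t [].
  move: tM; rewrite gt_max => /andP[t0 te].
  have [q [p [qk qt qp]]] := gamma_cond_approx _ _ _ _ _ _ tc.
  have q0 : q != 0.
    apply: contraTneq k0 => q0; rewrite -qk q0 -leqNgt leqn0 /nsupp cards_eq0.
    by apply/eqP/setP => i; rewrite !inE mxE eqxx.
  exists q; split => //; last first.
    exists p; apply: le_lt_trans qp _; rewrite -[e]lnK ?posrE// ltr_expR.
    have : 0 < c * tsum t by rewrite mulr_gt0.
    lra.
  split=> //; exists p; apply: le_trans qp _; rewrite powR_Pi_plus ler_expR.
  by rewrite wE !mulNr lerN2 -mulrA ler_wpM2l.
apply/lee_subgt0Pr => e e0; rewrite -EFinB; apply: omega_times_ge.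
(* Lowering the exponent makes the inequality strict only where [Pi_plus] exceeds 1, so finitely
   many [q] are dropped. *)
apply: sub_infinite_set (infinite_setD Ainf (finite_Pi_plus_le R n 1)).
move=> q /= [[_ [p qp]] /negP]; rewrite -ltNge => q1; exists p.
apply: le_lt_trans qp _; rewrite !powR_Pi_plus ltr_expR ltr_pM2r ?ln_gt0//.
have n0 : 0 < n%:R :> R.
  rewrite ltr0n lt0n; apply/eqP => n0; move: q1.
  rewrite /Pi_plus big1 ?ltxx// => i _; by case: i => i ilt; exfalso; move: (ilt); rewrite n0.
rewrite mulNr ltrN2 ltr_pdivrMr// mulrC; lra.
Qed.

(** * Bounds on [gamma] and comparison of the exponents *)

Definition gamma_set k :=
  [set c : R | 0 < c < k%:R^-1 /\ ~ bounded_set [set t | gamma_cond k y c t]].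

Lemma gamma_ubound k : ubound (gamma_set k) k%:R^-1.
Proof. by move=> c [/andP[_ /ltW]]. Qed.

Lemma gamma_ge k c : gamma_set k c -> c <= gamma k y.
Proof. by apply: ub_le_sup; exists k%:R^-1; exact: gamma_ubound. Qed.

(** The condition [0 <= b] covers the empty set, whose [sup] is 0. *)
Lemma gamma_le k b : 0 <= b -> ubound (gamma_set k) b -> gamma k y <= b.
Proof.
move=> b0 ub; rewrite /gamma -/(gamma_set k).
have [->|/set0P ne] := eqVneq (gamma_set k) set0; first by rewrite sup0.
exact: ge_sup.
Qed.

Lemma gamma_ge0 k : 0 <= gamma k y.
Proof.
have [e|/set0P[c ck]] := eqVneq (gamma_set k) set0.
  by rewrite /gamma -/(gamma_set k) e sup0.
by apply: le_trans (gamma_ge _ _ ck); case: ck => /andP[/ltW].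
Qed.

Lemma gamma_le_inv k : gamma k y <= k%:R^-1.
Proof. by apply: gamma_le; [rewrite invr_ge0 ler0n|exact: gamma_ubound]. Qed.

(** If [gamma k y] is [1 / k], a positive numerator over 0 gives [+oo]; otherwise the denominator is
    positive and can be cleared. *)
Lemma le_exponentE k (v : R) : (0 < n)%N -> (0 < k)%N ->
  (v%:E <= (n%:R + n%:R * gamma k y)%:E / (1 - k%:R * gamma k y)%:E)%E =
  (gamma k y == k%:R^-1) || (v - n%:R <= gamma k y * (n%:R + k%:R * v)).
Proof.
move=> n0 k0; have kR : 0 < k%:R :> R by rewrite ltr0n.
have nR : 0 < n%:R :> R by rewrite ltr0n.
have [->|gk] /= := eqVneq (gamma k y) k%:R^-1.
  rewrite divff ?gt_eqF// subrr inve0 gt0_muley ?leey// lte_fin.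
  by rewrite addr_gt0// mulr_gt0 ?invr_gt0.
have gk1 : 0 < 1 - k%:R * gamma k y.
  by rewrite subr_gt0 mulrC -ltr_pdivlMr// div1r lt_neqAle gk gamma_le_inv.
rewrite inver gt_eqF// lee_pdivlMr// -EFinM lee_fin.
by apply/idP/idP => h; lra.
Qed.

Lemma exponent_le_omega_times k : (0 < n)%N -> (0 < k)%N ->
  ((n%:R + n%:R * gamma k y)%:E / (1 - k%:R * gamma k y)%:E <= omega_times y)%E.
Proof.
move=> n0 k0; have kR : 0 < k%:R :> R by rewrite ltr0n.
have nR : 0 < n%:R :> R by rewrite ltr0n.
have := omega_times_ge_n n0; have := @omega_times_ge_gamma_cond k.
case: (omega_times y) => [w|_ _|//]; last exact: leey.
move=> wc; rewrite lee_fin => nw.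
have nkw : 0 < n%:R + w * k%:R by rewrite addr_gt0// mulr_gt0// (lt_le_trans nR).
(* The bound is the solution [c] of [n (1 + c) / (1 - k c) = w]. *)
have gw : gamma k y <= (w - n%:R) / (n%:R + w * k%:R).
  apply: gamma_le; first by rewrite divr_ge0 ?subr_ge0// ltW.
  move=> c [/andP[c0 ck] cb]; have kc : k%:R * c < 1.
    by rewrite mulrC -ltr_pdivlMr// div1r.
  move: (wc c k0 c0 kc cb); rewrite lee_fin mulrA ler_pdivrMr ?subr_gt0//.
  by rewrite ler_pdivlMr//; lra.
rewrite ler_pdivlMr// in gw.
(* A finite [w] keeps [gamma k y] away from [1 / k]: equality would give [n / k + w <= w - n]. *)
have gk1 : 0 < 1 - k%:R * gamma k y.
  rewrite subr_gt0 mulrC -ltr_pdivlMr// div1r lt_neqAle gamma_le_inv andbT.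
  apply/eqP => g; move: gw; rewrite g mulrDr mulrCA mulVf ?mulr1 ?gt_eqF//.
  have : 0 < k%:R^-1 * n%:R :> R by rewrite mulr_gt0 ?invr_gt0.
  lra.
by rewrite inver gt_eqF// lee_pdivrMr// -EFinM lee_fin; lra.
Qed.

(** Infinitely many of the solutions share one support size [k]. Were [gamma k y] below the [c]
    corresponding to [v], some [c'] strictly between them would be admissible for [gamma k y]. *)
Lemma le_exponent v : (0 < n)%N -> n%:R < v ->
  infinite_set [set q | exists p : int,
    `|inner q y + p%:~R| < Pi_plus R q `^ (- v / n%:R)] ->
  exists2 k, (0 < k <= n)%N &
  (v%:E <= (n%:R + n%:R * gamma k y)%:E / (1 - k%:R * gamma k y)%:E)%E.
Proof.
move=> n0 nv vinf; have nR : 0 < n%:R :> R by rewrite ltr0n.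
set A := (X in infinite_set X) in vinf.
have [k kn kinf] : exists2 k, (k <= n)%N & infinite_set (A `&` [set q | nsupp n q = k]).
  apply: contrapT => /forall2NP nk; apply: vinf.
  apply: sub_finite_set (bigcup_finite (finite_II n.+1) (F := fun k => A `&` [set q | nsupp n q = k]) _).
    move=> q Aq; exists (nsupp n q) => //=; rewrite ltnS.
    by rewrite -[leqRHS]card_ord max_card.
  by move=> k /= kn; have [//|/contrapT] := nk k.
(* Only [q = 0] has empty support. *)
have k0 : (0 < k)%N.
  rewrite lt0n; apply/eqP => k0; apply: kinf; rewrite k0.
  apply: sub_finite_set (finite_set1 0) => q /= [_ /eqP].
  rewrite cards_eq0 => /eqP q0; apply/rowP => i; rewrite mxE; apply/eqP.
  by have /setP/(_ i) := q0; rewrite !inE => /negbFE.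
exists k; first by rewrite k0.
have kR : 0 < k%:R :> R by rewrite ltr0n.
rewrite le_exponentE//; apply/orP; right.
have nkv : 0 < n%:R + k%:R * v by rewrite addr_gt0// mulr_gt0// (lt_trans nR).
rewrite -ler_pdivrMr// leNgt; apply/negP; set c := _ / _; move=> gc.
have cE : c * (n%:R + k%:R * v) = v - n%:R by rewrite divfK// gt_eqF.
move: c cE gc => c cE gc.
have kc : k%:R * c < 1.
  rewrite -(ltr_pM2r nkv) mul1r -mulrA cE mulrBr.
  have : 0 < k%:R * n%:R :> R by rewrite mulr_gt0.
  lra.
have cv : (1 + c) / (1 - k%:R * c) = v / n%:R.
  have kc0 : 1 - k%:R * c != 0 by rewrite gt_eqF// subr_gt0.
  by apply/eqP; rewrite eqr_div// ?(gt_eqF nR)//; apply/eqP; lra.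
have g0 := gamma_ge0 k.
have [c' /andP[gc' c'c]] : exists c', gamma k y < c' < c.
  by exists ((gamma k y + c) / 2); rewrite midf_lt//= midf_lt.
have : c' <= gamma k y; last by rewrite leNgt gc'.
have c'0 : 0 < c' := le_lt_trans g0 gc'.
apply: gamma_ge; split.
  rewrite c'0 -div1r ltr_pdivlMr// mulrC; apply: lt_trans kc.
  by rewrite ltr_pM2l.
apply: (unbounded_gamma_cond _ _ _ k c) => //; first by rewrite c'0.
apply: sub_infinite_set kinf => q /= [[p qp] qk]; split => //; exists p.
by rewrite cv -mulNr.
Qed.

End Exponent.

(* The quotient is taken in the extended reals, where [0^-1 = +oo]; it is [+oo]
   exactly when [gamma k y = 1 / k]. *)
Theorem theorem2p3 (R : realType) (n : nat) (hn : (0 < n)%N) (y : 'rV[R]_n) :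
  omega_times y =
  \big[maxe/-oo%E]_(1 <= k < n.+1)
     ((n%:R + n%:R * gamma k y)%:E / (1 - k%:R * gamma k y)%:E)%E.
Proof.
apply/eqP; rewrite eq_le; apply/andP; split; last first.
  rewrite big_nat; apply: bigmax_le => [|k /andP[k0 _]]; first exact: leNye.
  exact: exponent_le_omega_times.
apply: ge_ereal_sup => _ [v vinf <-].
have [k /andP[k0 kn] vk] : exists2 k, (0 < k <= n)%N &
    (v%:E <= (n%:R + n%:R * gamma k y)%:E / (1 - k%:R * gamma k y)%:E)%E.
  have [vn|nv] := leP v n%:R; last by apply: le_exponent => //.
  (* For [v <= n] the term [k = 1] is enough, since it is at least [n] by [gamma 1 y >= 0]. *)
  exists 1 => //; apply: le_trans (_ : (n%:R%:E <= _)%E); first by rewrite lee_fin.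
  by rewrite le_exponentE// subrr mulr_ge0 ?gamma_ge0 ?orbT// mul1r addr_ge0.
apply: le_trans vk _; apply: (le_bigmax_seq _ k) => //.
by rewrite mem_index_iota k0 ltnS.
Qed.
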